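(* Assume $\sigma_1(x)=\tfrac12\sigma_1''(0)(x-a_1)(x-b_1)$ and $\sigma_2(x)=\tfrac12\sigma_2''(0)(x-a_2)(x-b_2)$ with $\sigma_1''(0)\neq0$, $\sigma_2''(0)\neq0$ and real zeros satisfying $a_1<0<b_1<a_2\le b_2$, and assume $q^2\Lambda_q<0$, where $\Lambda_q=q^{-2}\Big[1+\frac{(1-q^{-1})\tau'(0)}{\frac12\sigma_1''(0)}\Big]$. Put $a=a_1$, $b=b_1$ and $$\rho(x)=\frac{(qx/a,\,qx/b;q)_\infty}{(x/a_2,\,x/b_2;q)_\infty}.$$ Then there exist polynomials $P_n$, $n\in\mathbb{N}_0$, with $P_n$ of degree $n$ a solution of the q-EHT with $\lambda=\lambda_n$, and nonzero constants $d_n^2$, such that for all $m,n\in\mathbb{N}_0$ $$\int_a^b P_n(x)P_m(x)\rho(x)\,d_qx=d_n^2\delta_{mn},$$ i.e. the $P_n$ are orthogonal with respect to $\rho$ supported on $\{q^ka\}_{k\in\mathbb{N}_0}\cup\{q^kb\}_{k\in\mathbb{N}_0}$.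
   Context: Throughout $0<q<1$. For a function $y$ and $\zeta\in\{q,q^{-1}\}$, $D_\zeta y(x)=\frac{y(x)-y(\zeta x)}{(1-\zeta)x}$ for $x\ne0$ and $D_\zeta y(0)=y'(0)$; $[n]_q=\frac{1-q^n}{1-q}$. Let $\sigma_1$ be a real polynomial of degree at most two, $\tau(x)=\tau'(0)x+\tau(0)$ a real polynomial with $\tau'(0)\ne0$, and $\sigma_2(x):=q[\sigma_1(x)+(1-q^{-1})x\tau(x)]$. The q-EHT with parameter $n\in\mathbb{N}_0$ is $\sigma_1(x)D_{q^{-1}}D_qy(x)+\tau(x)D_qy(x)+\lambda_ny(x)=0$, where $\lambda_n=-[n]_q\big(\tau'(0)+\tfrac12[n-1]_{q^{-1}}\sigma_1''(0)\big)$. Notation: $(\alpha;q)_\infty=\prod_{k\ge0}(1-\alpha q^k)$ and $(\alpha_1,\dots,\alpha_r;q)_\infty=\prod_{i}(\alpha_i;q)_\infty$. For $a<0<b$ the $q$-Jackson integral is $\int_a^b f(x)\,d_qx=(1-q)b\sum_{j\ge0}q^jf(q^jb)+(1-q)(-a)\sum_{j\ge0}q^jf(q^ja)$. *)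

(* Defs.v *)
From HB Require Import structures.
From mathcomp Require Import all_boot all_order all_algebra.
From mathcomp Require Import all_classical all_reals all_analysis.
Set Implicit Arguments. Unset Strict Implicit. Unset Printing Implicit Defensive.
Import Order.TTheory GRing.Theory Num.Theory.
Import numFieldNormedType.Exports.
Local Open Scope ring_scope.

Section QDefs.
Variable R : realType.

Definition qD (z : R) (f : R -> R) : R -> R :=
  fun x => if x == 0 then derive1 f 0 else (f x - f (z * x)) / ((1 - z) * x).

Definition qnum (q : R) (n : int) : R := (1 - q ^ n) / (1 - q).

Definition qpoch (q alpha : R) : R :=
  limn (fun N : nat => \prod_(k < N) (1 - alpha * q ^+ k)).

Definition jackson_right (q b : R) (f : R -> R) : nat -> R :=
  fun N => \sum_(j < N) q ^+ j * f (q ^+ j * b).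
Definition jackson_left (q a : R) (f : R -> R) : nat -> R :=
  fun N => \sum_(j < N) q ^+ j * f (q ^+ j * a).

Definition jackson_integrable (q a b : R) (f : R -> R) : Prop :=
  cvgn (jackson_right q b f) /\ cvgn (jackson_left q a f).

Definition jackson_int (q a b : R) (f : R -> R) : R :=
  (1 - q) * b * limn (jackson_right q b f)
  + (1 - q) * (- a) * limn (jackson_left q a f).

End QDefs.

(* Main.v *)
Require Import Defs.
From HB Require Import structures.
From mathcomp Require Import all_boot all_order all_algebra.
From mathcomp Require Import all_classical all_reals all_analysis.
From mathcomp Require Import ring lra.

Set Implicit Arguments.
Unset Strict Implicit.
Unset Printing Implicit Defensive.
Import Order.TTheory GRing.Theory Num.Theory.
Import numFieldNormedType.Exports.
Local Open Scope classical_set_scope.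
Local Open Scope ring_scope.

(** The q-EHT operator [L] is triangular on monomials, and its eigenvalues are
    distinct because [sigma1''(0)] and [sigma2''(0)] have opposite signs, so it
    has an eigenpolynomial of each degree. The weight satisfies the Pearson
    equation [rho x * sigma2 x = q * rho (q x) * sigma1 (q x)], so summing the
    q-Lagrange identity for [y L z - z L y] along [q^j c], with [c] a zero of
    [sigma1], telescopes to the limit at 0. This limit is the same for [c = a]
    and [c = b], and the two sides of the Jackson integral cancel. The squared
    norms are nonzero because the weight is positive on the support. *)

(** * Convergence and tails of infinite q-shifted factorials *)

(** Each factor obeys [1 + y <= expR y], and the exponents form a geometric series, so the bound
    does not depend on [N]. *)
Lemma prod1D_geom_le (R : realType) (q c : R) (N : nat) :
  0 <= q -> q < 1 -> 0 <= c ->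
  \prod_(k < N) (1 + c * q ^+ k) <= expR (c / (1 - q)).
Proof.
move=> q0 q1 c0.
have q1' : 1 - q != 0 by lra.
have iq0 : 0 < (1 - q)^-1 by rewrite invr_gt0; lra.
(* The exponent is sharpened to the partial geometric sum, a bound that induction on [N] can
   carry. *)
suff /le_trans : \prod_(k < N) (1 + c * q ^+ k)
    <= expR (c * (1 - q ^+ N) / (1 - q)).
  apply; rewrite ler_expR ler_wpM2r ?(ltW iq0)// ler_piMr//.
  by have := exprn_ge0 N q0; lra.
elim: N => [|N IH]; first by rewrite big_ord0 expr0 subrr mulr0 mul0r expR0.
rewrite big_ord_recr/=.
have -> : c * (1 - q ^+ N.+1) / (1 - q)
    = c * (1 - q ^+ N) / (1 - q) + c * q ^+ N by rewrite exprSr; field.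
have cq : 0 <= c * q ^+ N by rewrite mulr_ge0// exprn_ge0.
rewrite expRD ler_pM// ?expR_ge1Dx//; last by lra.
by apply: prodr_ge0 => k _; have := mulr_ge0 c0 (exprn_ge0 k q0); lra.
Qed.

(** The partial products are monotone: nondecreasing for [x <= 0], nonincreasing for [0 < x]. The
    limit is positive because they stay above 1 in the first case and above the inverse of an
    exponential in the second. *)
Lemma qpoch_cvg (R : realType) (q x : R) : 0 < q -> q < 1 -> x < 1 ->
  exists2 l : R, 0 < l &
    (fun N : nat => \prod_(k < N) (1 - x * q ^+ k)) @ \oo --> l.
Proof.
move=> q0 q1 x1.
set u := fun N : nat => _.
have qk0 k : 0 <= q ^+ k by rewrite exprn_ge0// ltW.
have qk1 k : q ^+ k <= 1 by rewrite exprn_ile1// ltW.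
have fac0 k : 0 < 1 - x * q ^+ k.
  have [x0|x0] := leP x 0.
    by have := mulr_le0_ge0 x0 (qk0 k); lra.
  by have := ler_piMr (ltW x0) (qk1 k); lra.
have u0 N : 0 < u N by apply: prodr_gt0.
suff [M M0 [cu Mu]] : exists2 M : R, 0 < M & cvgn u /\ forall N, M <= u N.
  exists (limn u) => //.
  by apply: (lt_le_trans M0); apply: limr_ge => //; near=> N.
have [x0|x0] := leP x 0.
  have u_ndecr : {homo u : n m / (n <= m)%N >-> n <= m}.
    apply/nondecreasing_seqP => N; rewrite /u big_ord_recr/= ler_peMr//; first exact: (ltW (u0 N)).
    by have := mulr_le0_ge0 x0 (qk0 N); lra.
  exists 1 => //; split; last first.
    by move=> N; apply: le_trans (u_ndecr _ _ (leq0n N)); rewrite /u big_ord0.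
  apply: nondecreasing_is_cvgn => //; exists (expR (- x / (1 - q))) => _ [N _ <-].
  have nx0 : 0 <= - x by rewrite oppr_ge0.
  apply: le_trans (@prod1D_geom_le _ q (- x) N (ltW q0) q1 nx0).
  by rewrite le_eqVlt; apply/orP; left; apply/eqP/eq_bigr => k _; rewrite mulNr.
have x1' : 0 < 1 - x by lra.
pose c := x / (1 - x).
have c0 : 0 <= c by rewrite divr_ge0 ?ltW.
(* (1 - t)(1 + t/(1-x)) >= 1 for 0 <= t <= x *)
have uc N : 1 <= u N * \prod_(k < N) (1 + c * q ^+ k).
  rewrite /u -big_split/=; elim/big_ind: _ => //.
    by move=> y z y1 z1; rewrite -(mulr1 1) ler_pM.
  move=> k _; rewrite /c.
  rewrite -(ler_pM2r x1').
  have -> : (1 - x * q ^+ k) * (1 + x / (1 - x) * q ^+ k) * (1 - x)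
    = (1 - x * q ^+ k) * (1 - x + x * q ^+ k) by field; lra.
  have := mulr_ge0 (mulr_ge0 (ltW x0) (qk0 k))
    (mulr_ge0 (ltW x0) (_ : 0 <= 1 - q ^+ k)).
  by rewrite subr_ge0 => /(_ (qk1 k)); nra.
have Mu N : expR (- (c / (1 - q))) <= u N.
  rewrite expRN -div1r ler_pdivrMr ?expR_gt0//.
  apply: le_trans (uc N) _.
  by rewrite ler_pM2l// prod1D_geom_le// ltW.
exists (expR (- (c / (1 - q)))); first exact: expR_gt0.
split=> //; apply: nonincreasing_is_cvgn; last first.
  by exists (expR (- (c / (1 - q)))) => _ [N _ <-].
apply/nonincreasing_seqP => N; rewrite /u big_ord_recr/= ler_piMr//; first exact: (ltW (u0 N)).
by have := mulr_ge0 (ltW x0) (qk0 N); lra.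
Unshelve. all: by end_near.
Qed.

Lemma qpoch_gt0 (R : realType) (q x : R) :
  0 < q -> q < 1 -> x < 1 -> 0 < qpoch q x.
Proof.
move=> q0 q1 x1; have [l l0 ul] := qpoch_cvg q0 q1 x1.
by rewrite /qpoch (cvg_lim _ ul).
Qed.

Lemma ltr1_pMl (R : realType) (q x : R) : 0 <= q -> q <= 1 -> x < 1 -> q * x < 1.
Proof. by move=> q0 q1 x1; have [x0|x0] := leP x 0; nra. Qed.

Lemma qpoch_rec (R : realType) (q x : R) : 0 < q -> q < 1 -> x < 1 ->
  qpoch q x = (1 - x) * qpoch q (q * x).
Proof.
move=> q0 q1 x1.
have qx1 := ltr1_pMl (ltW q0) (ltW q1) x1.
have [l _ ul] := qpoch_cvg q0 q1 x1.
have [l' _ ul'] := qpoch_cvg q0 q1 qx1.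
rewrite /qpoch (cvg_lim _ ul)// (cvg_lim _ ul')//.
move: ul; rewrite -cvg_shiftS/= => ul.
apply: cvg_unique ul _ => //.
have -> : (fun N : nat => \prod_(k < N.+1) (1 - x * q ^+ k))
    = (fun N => (1 - x) * \prod_(k < N) (1 - q * x * q ^+ k)).
  apply/funext => N; rewrite big_ord_recl/= expr0 mulr1; congr (_ * _).
  by apply: eq_bigr => k _; rewrite exprS; ring.
by apply: cvgM ul'; exact: cvg_cst.
Qed.

(** The tail after [j] factors is the full product divided by the [j]-th partial product, which has
    the same nonzero limit. *)
Lemma qpoch_tail (R : realType) (q x : R) : 0 < q -> q < 1 -> x < 1 ->
  (fun j : nat => qpoch q (q ^+ j * x)) @ \oo --> (1 : R).
Proof.
move=> q0 q1 x1.
have [l l0 ul] := qpoch_cvg q0 q1 x1.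
have ql : qpoch q x = l by rewrite /qpoch (cvg_lim _ ul).
have qx1 j : q ^+ j * x < 1.
  by rewrite ltr1_pMl// ?exprn_ge0 ?exprn_ile1// ltW.
have E j : qpoch q (q ^+ j * x) = l / \prod_(k < j) (1 - x * q ^+ k).
  elim: j => [|j IH]; first by rewrite big_ord0 divr1 expr0 mul1r.
  have xj : 1 - x * q ^+ j != 0 by have := qx1 j; lra.
  move: IH; rewrite qpoch_rec// mulrA -exprS big_ord_recr/= => IH.
  apply: (mulfI xj); rewrite [q ^+ j * x]mulrC in IH; rewrite IH invfM.
  by rewrite [RHS]mulrC -!mulrA mulVf// mulr1.
under eq_fun do rewrite E.
have l_neq0 := lt0r_neq0 l0.
suff : (fun j : nat => l / \prod_(k < j) (1 - x * q ^+ k)) @ \oo --> l / l.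
  by rewrite divff.
by apply: cvgM; [exact: cvg_cst | exact: cvgV].
Qed.

(** * The q-difference operator on polynomials *)

(** Defining it on coefficients removes the case split at 0 that [qD] has. *)
Definition qDpoly (R : realType) (z : R) (p : {poly R}) : {poly R} :=
  \poly_(i < size p) ((1 - z ^+ i.+1) / (1 - z) * p`_i.+1).

Lemma coef_qDpoly (R : realType) (z : R) (p : {poly R}) (i : nat) :
  (qDpoly z p)`_i = (1 - z ^+ i.+1) / (1 - z) * p`_i.+1.
Proof.
rewrite coef_poly; case: ltnP => // pi.
by rewrite nth_default ?mulr0// (leq_trans pi).
Qed.

Lemma qDpolyD (R : realType) (z : R) (p r : {poly R}) :
  qDpoly z (p + r) = qDpoly z p + qDpoly z r.
Proof. by apply/polyP => i; rewrite !(coefD, coef_qDpoly) mulrDr. Qed.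

Lemma qDpolyZ (R : realType) (z c : R) (p : {poly R}) :
  qDpoly z (c *: p) = c *: qDpoly z p.
Proof. by apply/polyP => i; rewrite !(coefZ, coef_qDpoly) mulrCA. Qed.

Lemma qDpolyXn (R : realType) (z : R) (k : nat) :
  qDpoly z 'X^k = ((1 - z ^+ k) / (1 - z)) *: 'X^(k.-1).
Proof.
apply/polyP => i; rewrite coefZ coef_qDpoly !coefXn.
case: k => [|k] /=; last by rewrite eqSS; case: eqP => [->|_]; rewrite ?mulr0.
by rewrite expr0 subrr !mul0r mulr0.
Qed.

Lemma qDpoly_diff (R : realType) (z : R) (p : {poly R}) (x : R) : z != 1 ->
  (1 - z) * x * (qDpoly z p).[x] = p.[x] - p.[z * x].
Proof.
move=> z1; have z1' : 1 - z != 0 by rewrite subr_eq0 eq_sym.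
rewrite !(@horner_coef_wide _ (size p).+1 p) // -sumrB big_ord_recl/=.
rewrite !expr0 subrr add0r (horner_coef_wide _ (size_poly _ _)) mulr_sumr.
apply: eq_bigr => i _; rewrite coef_qDpoly /bump/= add1n exprMn !exprS.
by field.
Qed.

Lemma qD_horner (R : realType) (z : R) (p : {poly R}) : z != 1 ->
  qD z (fun x => p.[x]) = (fun x => (qDpoly z p).[x]).
Proof.
move=> z1; have z1' : 1 - z != 0 by rewrite subr_eq0 eq_sym.
apply/funext => x; rewrite /qD; case: eqP => [->|/eqP x0].
  (* At 0, where [qD] is the derivative, both sides are the linear coefficient of [p]. *)
  by rewrite -derivE !horner_coef0 coef_deriv coef_qDpoly expr1 divff// mul1r.
by rewrite -qDpoly_diff// mulrAC divff ?mul1r// mulf_neq0.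
Qed.

(** * Eigenpolynomials of the q-EHT operator *)

(** The eigenvector is ['X^n] plus a correction of lower degree. The correction exists because
    [L - e n] is triangular below degree [n] with nonzero diagonal entries [e k - e n]. *)
Lemma triangular_eigenpoly (R : fieldType) (L : {linear {poly R} -> {poly R}})
    (e : nat -> R) (n : nat) :
  (forall k, (size (L 'X^k - e k *: 'X^k)%R <= k)%N) ->
  (forall k, (k < n)%N -> e k != e n) ->
  exists2 p : {poly R}, size p = n.+1 & L p = e n *: p.
Proof.
move=> Ltri en.
have solve k : (k <= n)%N -> forall g : {poly R}, (size g <= k)%N ->
    exists2 h : {poly R}, (size h <= k)%N & L h - e n *: h = g.
  elim: k => [_ g|k IH kn g sg].
    rewrite leqn0 size_poly_eq0 => /eqP ->.
    by exists 0; rewrite ?size_poly0// linear0 scaler0 subr0.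
  have ek : e k - e n != 0 by rewrite subr_eq0 en.
  (* This choice cancels the coefficient of degree [k] and leaves a right-hand side of size at most
     [k]. *)
  pose c := g`_k / (e k - e n).
  have [|h sh Eh] := IH (ltnW kn) (g - c *: (L 'X^k - e n *: 'X^k)).
    apply/leq_sizeP => j kj.
    have /leq_sizeP/(_ _ kj) := Ltri k.
    rewrite !(coefB, coefZ) coefXn => /eqP; rewrite subr_eq0 => /eqP ->.
    rewrite -mulrBl; move: kj; rewrite leq_eqVlt => /orP[/eqP <-|kj].
      by rewrite eqxx mulr1 /c divfK// subrr.
    by rewrite gtn_eqF// !mulr0 subr0; apply/leq_sizeP: kj.
  exists (c *: 'X^k + h).
    rewrite (leq_trans (size_polyD _ _))// geq_max (leq_trans sh)// andbT.
    by rewrite (leq_trans (size_scale_leq _ _))// size_polyXn.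
  rewrite linearP scalerDr opprD addrACA Eh [e n *: (c *: _)]scalerA.
  by rewrite [e n * c]mulrC -[(c * e n) *: _]scalerA -scalerBr addrC subrK.
have [|h sh Eh] := solve n (leqnn n) (- (L 'X^n - e n *: 'X^n)).
  by rewrite size_polyN.
exists ('X^n + h); first by rewrite size_polyDl size_polyXn.
by apply/eqP; rewrite -subr_eq0 linearD scalerDr opprD addrACA Eh subrr.
Qed.

(** The [lambda] term is left out, so that solutions of the q-EHT become eigenvectors with
    eigenvalue [- lambda]. *)
Definition qEHT (R : realType) (q : R) (s t p : {poly R}) : {poly R} :=
  s * qDpoly q^-1 (qDpoly q p) + t * qDpoly q p.

Lemma qEHT_is_linear (R : realType) (q : R) (s t : {poly R}) :
  linear (qEHT q s t).
Proof.
move=> c p r; rewrite /qEHT !(qDpolyD, qDpolyZ) !mulrDr -!scalerAr scalerDr.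
by rewrite addrACA.
Qed.

HB.instance Definition _ (R : realType) (q : R) (s t : {poly R}) :=
  GRing.isLinear.Build R {poly R} {poly R} *:%R (qEHT q s t)
    (qEHT_is_linear q s t).

(** The diagonal entry at ['X^k]. The truncation of [k.-1] at [k = 0] is harmless, since the first
    factor vanishes there. *)
Definition qEHT_eigenvalue (R : realType) (q : R) (s t : {poly R}) (k : nat) : R :=
  (1 - q ^+ k) / (1 - q) * (t`_1 + s`_2 * ((1 - q^-1 ^+ k.-1) / (1 - q^-1))).

(** Each q-difference lowers the degree by one, and the factors [s] and [t] raise it by at most as
    much. *)
Lemma qEHT_triangular (R : realType) (q : R) (s t : {poly R}) (k : nat) :
  (size s <= 3)%N -> (size t <= 2)%N ->
  (size (qEHT q s t 'X^k - qEHT_eigenvalue q s t k *: 'X^k)%R <= k)%N.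
Proof.
move=> s3 t2; apply/leq_sizeP => j kj; rewrite /qEHT.
rewrite !(qDpolyXn, qDpolyZ) -!scalerAr !(coefN, coefD, coefZ) !coefMXn coefXn.
rewrite /qEHT_eigenvalue.
(* Degrees 0 and 1 are separate because predecessors in the exponents truncate there. *)
case: k kj => [|[|k]] kj /=.
- by rewrite !expr0; ring.
- rewrite expr0 subrr mul0r ?subn0.
  move: kj; rewrite leq_eqVlt => /orP[/eqP <-|j1]; first by rewrite eqxx mulr1; ring.
  by rewrite (leq_sizeP _ _ t2)// gtn_eqF// mulr0n; ring.
rewrite ltnNge (ltnW (ltnW kj)) ltnNge (ltnW kj)/=.
move: kj; rewrite leq_eqVlt => /orP[/eqP <-|j2].
  by rewrite eqxx mulr1 !subSS subSnn subSn// subSnn; ring.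
have -> : s`_(j - k) = 0 by apply: (leq_sizeP _ _ s3); rewrite ltn_subRL addn2.
have -> : t`_(j - k.+1) = 0 by apply: (leq_sizeP _ _ t2); rewrite ltn_subRL addn1.
by rewrite gtn_eqF// mulr0n; ring.
Qed.

(** The hypothesis says that sigma1 and sigma2 have quadratic coefficients of opposite signs, which
    keeps the last factor of the eigenvalue difference from vanishing. *)
Lemma qEHT_eigenvalue_inj (R : realType) (q : R) (s t : {poly R}) (k n : nat) :
  0 < q -> q < 1 -> s`_2 * (q * (s`_2 + (1 - q^-1) * t`_1)) < 0 -> (k < n)%N ->
  qEHT_eigenvalue q s t k != qEHT_eigenvalue q s t n.
Proof.
move=> q0 q1; set r := q * _ => sr kn.
have q0' : q != 0 by rewrite gt_eqF.
have q1' : 1 - q != 0 by rewrite subr_eq0 gt_eqF.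
(* Trading the coefficient of [t] for [r] makes the eigenvalue a function of [q ^+ m], whose
   differences factor. *)
have E m : qEHT_eigenvalue q s t m
    = q / (1 - q) ^+ 2 * (1 - q ^+ m) * (s`_2 * q / q ^+ m - r / q).
  rewrite /qEHT_eigenvalue /r; case: m => [|m] /=.
    by rewrite expr0 subrr !(mul0r, mulr0).
  rewrite exprVn exprS; field.
  by rewrite q0' expf_neq0// q1' -oppr_eq0 opprB.
rewrite !E -subr_eq0; set A := q ^+ k; set B := q ^+ n.
have A0 : 0 < A by apply: exprn_gt0.
have B0 : 0 < B by apply: exprn_gt0.
have AB : B < A by rewrite ltr_iXn2l.
have -> : q / (1 - q) ^+ 2 * (1 - A) * (s`_2 * q / A - r / q)
    - q / (1 - q) ^+ 2 * (1 - B) * (s`_2 * q / B - r / q)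
  = q / (1 - q) ^+ 2 * ((A - B) * (r / q - s`_2 * q / (A * B))).
  by field; rewrite q0' q1' !gt_eqF.
have c0 : 0 < q / (1 - q) ^+ 2 by rewrite divr_gt0// exprn_gt0// subr_gt0.
apply: mulf_neq0; first exact: lt0r_neq0.
apply: mulf_neq0; first by rewrite subr_eq0 gt_eqF.
apply/eqP => H.
(* Multiplied by the quadratic coefficient of [s], the vanishing factor becomes a negative number
   minus a nonnegative one. *)
have : s`_2 * r / q - s`_2 ^+ 2 * (q / (A * B)) = 0.
  by transitivity (s`_2 * (r / q - s`_2 * q / (A * B))); [ring | rewrite H mulr0].
have : s`_2 * r / q < 0 by rewrite pmulr_llt0// invr_gt0.
have : 0 <= s`_2 ^+ 2 * (q / (A * B)).
  by rewrite mulr_ge0 ?sqr_ge0// divr_ge0 ?mulr_ge0 ?ltW.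
lra.
Qed.

(** * The q-Lagrange identity *)

(** The q-analogue of the Wronskian. *)
Definition qcasoratian (R : realType) (q : R) (y z : {poly R}) : {poly R} :=
  z * qDpoly q y - y * qDpoly q z.

(** As in Sturm-Liouville theory, the equations are cross-multiplied by [z] and [y] and subtracted.
    The Casoratian at [x] gets the factor sigma2 and the one at [q^-1 * x] gets [q] times sigma1,
    the pair linked by the Pearson equation. *)
Lemma qEHT_lagrange (R : realType) (q e e' : R) (s t y z : {poly R}) (x : R) :
  q != 0 -> q != 1 -> qEHT q s t y = e *: y -> qEHT q s t z = e' *: z ->
  (q - 1) * (e - e') * x * (y.[x] * z.[x])
  = q * (s.[x] + (1 - q^-1) * x * t.[x]) * (qcasoratian q y z).[x]
    - q * s.[x] * (qcasoratian q y z).[q^-1 * x].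
Proof.
move=> q0 q1 Ey Ez.
have qV1 : q^-1 != 1 by rewrite invr_eq1.
have step p : p.[x] = p.[q^-1 * x]
    - (1 - q) * (q^-1 * x) * (qDpoly q p).[q^-1 * x].
  by rewrite qDpoly_diff// mulVKf// opprB addrCA subrr addr0.
have D2 p := qDpoly_diff (qDpoly q p) x qV1.
have := congr1 (horner^~ x) Ey; have := congr1 (horner^~ x) Ez.
rewrite /qcasoratian !(hornerM, hornerD, hornerN, hornerZ) => Hz Hy.
have -> : (q - 1) * (e - e') * x * (y.[x] * z.[x])
    = q * (1 - q^-1) * x * (z.[x] * (e * y.[x]) - y.[x] * (e' * z.[x])) by field.
rewrite -Hy -Hz.
have -> : q * (1 - q^-1) * x *
    (z.[x] * (s.[x] * (qDpoly q^-1 (qDpoly q y)).[x] + t.[x] * (qDpoly q y).[x])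
     - y.[x] * (s.[x] * (qDpoly q^-1 (qDpoly q z)).[x] + t.[x] * (qDpoly q z).[x]))
  = q * s.[x] * (z.[x] * ((1 - q^-1) * x * (qDpoly q^-1 (qDpoly q y)).[x])
                 - y.[x] * ((1 - q^-1) * x * (qDpoly q^-1 (qDpoly q z)).[x]))
    + q * (1 - q^-1) * x * t.[x]
      * (z.[x] * (qDpoly q y).[x] - y.[x] * (qDpoly q z).[x]) by ring.
rewrite !D2.
(* In the shifted products, [z] and [y] may move from [x] to [q^-1 * x]: by [step] the two resulting
   changes are equal and cancel. *)
have -> : z.[x] * ((qDpoly q y).[x] - (qDpoly q y).[q^-1 * x])
    - y.[x] * ((qDpoly q z).[x] - (qDpoly q z).[q^-1 * x])
  = z.[x] * (qDpoly q y).[x] - y.[x] * (qDpoly q z).[x]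
    - (z.[q^-1 * x] * (qDpoly q y).[q^-1 * x]
       - y.[q^-1 * x] * (qDpoly q z).[q^-1 * x]).
  have Sy := step y; have Sz := step z.
  rewrite [X in _ * (_ - _) - X * _]Sy.
  rewrite [X in X * (_ - _) - _]Sz.
  rewrite [y.[x]]Sy [z.[x]]Sz; ring.
ring.
Qed.

(** * Weighted sums along the nodes [q^j c] *)

(** A convergent sequence is bounded, so a geometric series dominates the terms. *)
Lemma is_cvg_qgeom_sum (R : realType) (q : R) (v : nat -> R) :
  0 < q -> q < 1 -> cvgn v -> cvgn (fun N => \sum_(j < N) q ^+ j * v j).
Proof.
move=> q0 q1 cv.
have [M [Mreal vM]] := cvg_seq_bounded cv.
pose B := `|M| + 1.
have B0 : 0 <= B by rewrite /B addr_ge0.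
have vB j : `|v j| <= B.
  by apply: (vM B) => //; rewrite /B (le_lt_trans (ler_norm _))// ltrDl.
have -> : (fun N => \sum_(j < N) q ^+ j * v j)
    = series (fun j => q ^+ j * v j).
  by apply/funext => N; rewrite /series/= big_mkord.
apply: normed_cvg; apply: (@series_le_cvg _ _ (geometric B q)).
- by move=> j; exact: normr_ge0.
- by move=> j; rewrite mulr_ge0// exprn_ge0// ltW.
- by move=> j; rewrite /= normrM mulrC ler_pM// ger0_norm// exprn_ge0// ltW.
by apply: is_cvg_geometric_series; rewrite ger0_norm// ltW.
Qed.

Lemma cvg_horner_qgeom (R : realType) (q c : R) (p : {poly R}) :
  0 < q -> q < 1 -> (fun j : nat => p.[q ^+ j * c]) @ \oo --> p.[0].
Proof.
move=> q0 q1; apply: (@continuous_cvg _ _ _ _ _ (fun j : nat => q ^+ j * c)).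
  exact: continuous_horner.
rewrite -(mul0r c); apply: cvgM; last exact: cvg_cst.
by apply: cvg_expr; rewrite ger0_norm// ltW.
Qed.

Section OneSided.
Variables (R : realType) (q c : R) (s t : {poly R}) (w : nat -> R).
Hypotheses (q0 : 0 < q) (q1 : q < 1) (sc : s.[c] = 0) (w1 : w @ \oo --> (1 : R)).
Let sigma2 x := q * (s.[x] + (1 - q^-1) * x * t.[x]).
Hypothesis pearson : forall j,
  w j * sigma2 (q ^+ j * c) = q * w j.+1 * s.[q ^+ j.+1 * c].

Lemma cvg_poly_weight (p : {poly R}) :
  (fun j => p.[q ^+ j * c] * w j) @ \oo --> p.[0].
Proof.
by rewrite -[X in _ --> X]mulr1; apply: cvgM w1; exact: cvg_horner_qgeom.
Qed.

Lemma is_cvg_poly_sum (p : {poly R}) :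
  cvgn (fun N => \sum_(j < N) q ^+ j * (p.[q ^+ j * c] * w j)).
Proof.
apply: (@is_cvg_qgeom_sum _ _ (fun j => p.[q ^+ j * c] * w j)) => //.
by apply/cvg_ex; exists p.[0]; exact: cvg_poly_weight.
Qed.

(** The right-hand side does not involve [c], so the sums from two different endpoints can be
    compared. *)
Lemma lagrange_limit (e e' : R) (y z : {poly R}) :
  qEHT q s t y = e *: y -> qEHT q s t z = e' *: z ->
  (q - 1) * (e - e') * c
    * limn (fun N => \sum_(j < N) q ^+ j * ((y * z).[q ^+ j * c] * w j))
  = q * s.[0] * (qcasoratian q y z).[0].
Proof.
move=> Ey Ez; set V := qcasoratian q y z.
have q0' : q != 0 by rewrite gt_eqF.
have q1' : q != 1 by rewrite lt_eqF.
set S := fun N : nat => _.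
(* The q-Lagrange identity makes the weighted sum telescope; [s.[c] = 0]
   kills the boundary term at [c]. *)
have S_telescope N : (q - 1) * (e - e') * c * S N.+1
    = w N * sigma2 (q ^+ N * c) * V.[q ^+ N * c].
  have L j := qEHT_lagrange (q ^+ j * c) q0' q1' Ey Ez.
  have term j : (q - 1) * (e - e') * c
      * (q ^+ j * ((y * z).[q ^+ j * c] * w j))
    = w j * sigma2 (q ^+ j * c) * V.[q ^+ j * c]
      - q * w j * s.[q ^+ j * c] * V.[q^-1 * (q ^+ j * c)].
    rewrite hornerM; transitivity (w j * ((q - 1) * (e - e') * (q ^+ j * c)
      * (y.[q ^+ j * c] * z.[q ^+ j * c]))); first by ring.
    by rewrite L /sigma2 -/V; ring.
  elim: N => [|N IH]; rewrite /S big_ord_recr/= mulrDr.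
    by rewrite big_ord0 mulr0 add0r term expr0 mul1r sc mulr0 mul0r subr0.
  rewrite -/(S N.+1) IH term -pearson.
  rewrite (_ : q^-1 * (q ^+ N.+1 * c) = q ^+ N * c); last first.
    by rewrite exprS -mulrA mulKf.
  by rewrite addrC subrK.
have cS : (fun N => (q - 1) * (e - e') * c * S N.+1) @ \oo -->
    (q - 1) * (e - e') * c * limn S.
  apply: cvgM; first exact: cvg_cst.
  by rewrite (cvg_shiftS S); exact: is_cvg_poly_sum.
apply: cvg_unique cS _ => //.
(* This is sigma2 times the Casoratian as a polynomial; at 0 the [t] term drops out because of its
   factor ['X]. *)
pose W : {poly R} := (q *: (s + ((1 - q^-1) *: 'X) * t)) * V.
have -> : q * s.[0] * V.[0] = W.[0].
  by rewrite /W !(hornerM, hornerD, hornerZ, hornerX) mulr0 mul0r addr0.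
have E : (fun N => W.[q ^+ N * c] * w N)
    = (fun N => (q - 1) * (e - e') * c * S N.+1).
  apply/funext => N; rewrite S_telescope /W /sigma2.
  by rewrite !(hornerM, hornerD, hornerZ, hornerX); ring.
by rewrite -E; exact: cvg_poly_weight.
Qed.

(** The terms are nonnegative, and one is positive since a nonzero polynomial cannot vanish at
    infinitely many distinct nodes. *)
Lemma qsum_sqr_gt0 (p : {poly R}) : (forall j, 0 < w j) -> c != 0 -> p != 0 ->
  0 < limn (fun N => \sum_(j < N) q ^+ j * ((p * p).[q ^+ j * c] * w j)).
Proof.
move=> w0 c0 p0; set u := fun N : nat => _.
have term_ge0 j : 0 <= q ^+ j * ((p * p).[q ^+ j * c] * w j).
  apply: mulr_ge0; first by rewrite exprn_ge0// ltW.
  by apply: mulr_ge0; [rewrite hornerM -expr2 sqr_ge0 | exact: ltW].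
have [j pj] : exists j : nat, p.[q ^+ j * c] != 0.
  apply/not_existsP => all_root.
  (* The first [size p] nodes would already be too many roots. *)
  have := @max_poly_roots _ p [seq q ^+ j * c | j <- iota 0 (size p)] p0.
  rewrite size_map size_iota ltnn => too_many; apply/notF/too_many.
    apply/allP => _ /mapP[j _ ->]; rewrite /root.
    by apply: contrapT => /negP; exact: all_root.
  rewrite map_inj_uniq ?iota_uniq// => i j /(mulIf c0).
  by apply: ieexprIn; rewrite ?lt_eqF.
have uj : 0 < u j.+1.
  rewrite /u big_ord_recr/= ltr_wpDl ?sumr_ge0// hornerM -expr2.
  apply: mulr_gt0; first exact: exprn_gt0.
  by apply: mulr_gt0 (w0 j); rewrite exprn_even_gt0.
apply: (lt_le_trans uj); apply: nondecreasing_cvgn_le; last exact: is_cvg_poly_sum.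
by apply/nondecreasing_seqP => N; rewrite /u big_ord_recr/= lerDl.
Qed.

End OneSided.

(** * The weight and its Pearson equation *)

Definition bigqjacobi_weight (R : realType) (q a b a2 b2 x : R) : R :=
  qpoch q (q * x / a) * qpoch q (q * x / b)
  / (qpoch q (x / a2) * qpoch q (x / b2)).

Section Weight.
Variables (R : realType) (q a b a2 b2 c : R).
Hypotheses (q0 : 0 < q) (q1 : q < 1).
Hypotheses (ca : q * c / a < 1) (cb : q * c / b < 1).
Hypotheses (ca2 : c / a2 < 1) (cb2 : c / b2 < 1).
Let w j := bigqjacobi_weight q a b a2 b2 (q ^+ j * c).

Let wE j : w j = qpoch q (q ^+ j * (q * c / a)) * qpoch q (q ^+ j * (q * c / b))
  / (qpoch q (q ^+ j * (c / a2)) * qpoch q (q ^+ j * (c / b2))).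
Proof.
by rewrite /w /bigqjacobi_weight !mulrA ![q * q ^+ j]mulrC.
Qed.

Let lt1 j y : y < 1 -> q ^+ j * y < 1.
Proof. by move=> y1; rewrite ltr1_pMl// ?exprn_ge0 ?exprn_ile1// ltW. Qed.

(** The section hypotheses keep all four arguments below 1 along the nodes, so every q-shifted
    factorial is positive. *)
Lemma bigqjacobi_weight_gt0 j : 0 < w j.
Proof. by rewrite wE divr_gt0// mulr_gt0// qpoch_gt0// lt1. Qed.

Lemma bigqjacobi_weight_cvg : w @ \oo --> (1 : R).
Proof.
have -> : w = fun j => qpoch q (q ^+ j * (q * c / a)) * qpoch q (q ^+ j * (q * c / b))
  / (qpoch q (q ^+ j * (c / a2)) * qpoch q (q ^+ j * (c / b2))).
  by apply/funext => j; rewrite wE.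
have one : 1 * 1 / (1 * 1) = 1 :> R by rewrite !(mulr1, invr1).
rewrite -[X in _ --> X]one.
apply: cvgM; first by apply: cvgM; exact: qpoch_tail.
by apply: cvgV; rewrite ?mulr1 ?oner_neq0// -[X in _ --> X]mulr1;
  apply: cvgM; exact: qpoch_tail.
Qed.

(** [qpoch_rec] is applied once to each of the four factors. Up to constants this is the Pearson
    equation, with sigma2 on the left and sigma1 on the right. *)
Lemma bigqjacobi_weight_rec j :
  w j * ((1 - q ^+ j * c / a2) * (1 - q ^+ j * c / b2))
  = (1 - q ^+ j.+1 * c / a) * (1 - q ^+ j.+1 * c / b) * w j.+1.
Proof.
have rec y : y < 1 -> qpoch q (q ^+ j * y)
    = (1 - q ^+ j * y) * qpoch q (q ^+ j.+1 * y).
  by move=> y1; rewrite exprS -mulrA; apply: qpoch_rec => //; exact: lt1.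
have nz y : y < 1 -> qpoch q (q ^+ j.+1 * y) != 0.
  by move=> y1; rewrite gt_eqF// qpoch_gt0// lt1.
have nz1 y : y < 1 -> 1 - q ^+ j * y != 0.
  by move=> y1; rewrite subr_eq0 gt_eqF// lt1.
rewrite !wE (rec _ ca) (rec _ cb) (rec _ ca2) (rec _ cb2).
rewrite -![q ^+ j * c / _]mulrA.
rewrite (_ : q ^+ j.+1 * c / a = q ^+ j * (q * c / a)); last by rewrite exprSr; ring.
rewrite (_ : q ^+ j.+1 * c / b = q ^+ j * (q * c / b)); last by rewrite exprSr; ring.
move: (nz _ ca2) (nz _ cb2) (nz1 _ ca2) (nz1 _ cb2).
set A := qpoch q (q ^+ j.+1 * (c / a2)); set B := qpoch q (q ^+ j.+1 * (c / b2)).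
set C := 1 - q ^+ j * (c / a2); set D := 1 - q ^+ j * (c / b2).
set X := q * c / a; set Y := q * c / b.
by move=> A0 B0 C0 D0; field; rewrite A0 B0 C0 D0.
Qed.

End Weight.

(** * Assembly of the orthogonality relation *)

(** At [n = 0] the exponents 0 and -1 differ, but the prefactor vanishes. *)
Lemma qEHT_eigenvalueE (R : realType) (q : R) (s t : {poly R}) (n : nat) :
  qEHT_eigenvalue q s t n
  = qnum q n%:Z * (t`_1 + s`_2 * qnum q^-1 (n%:Z - 1)).
Proof.
rewrite /qEHT_eigenvalue /qnum; case: n => [|n] /=.
  by rewrite expr0 expr0z subrr !mul0r.
by rewrite (_ : n.+1%:Z - 1 = n%:Z)// -addn1 PoszD addrK.
Qed.

Unset Implicit Arguments.

(* s1 = sigma1''(0), s2 = sigma2''(0); tau x = t1 * x + t0 (t1 = tau'(0)).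
   sigma1 x = s1/2 (x - a1)(x - b1);
   sigma2 x = q [sigma1 x + (1 - q^-1) x tau x], assumed = s2/2 (x - a2)(x - b2). *)
Theorem theorem4p5 (R : realType) (q s1 s2 t1 t0 a1 b1 a2 b2 : R) :
  0 < q -> q < 1 ->
  t1 != 0 -> s1 != 0 -> s2 != 0 ->
  a1 < 0 -> 0 < b1 -> b1 < a2 -> a2 <= b2 ->
  (forall x : R,
     q * (s1 / 2 * (x - a1) * (x - b1) + (1 - q^-1) * x * (t1 * x + t0))
     = s2 / 2 * (x - a2) * (x - b2)) ->
  q ^+ 2 * (q ^- 2 * (1 + (1 - q^-1) * t1 / (s1 / 2))) < 0 ->
  let sigma1 := fun x : R => s1 / 2 * (x - a1) * (x - b1) in
  let tau := fun x : R => t1 * x + t0 in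
  let lambda := fun n : nat =>
    - qnum q n%:Z * (t1 + 1 / 2 * qnum q^-1 (n%:Z - 1) * s1) in
  let a := a1 in
  let b := b1 in
  let rho := fun x : R =>
    qpoch q (q * x / a) * qpoch q (q * x / b)
    / (qpoch q (x / a2) * qpoch q (x / b2)) in
  exists (P : nat -> {poly R}) (d2 : nat -> R),
    (forall n, size (P n) = n.+1) /\
    (forall n (x : R),
       sigma1 x * qD q^-1 (qD q (fun y => (P n).[y])) x
       + tau x * qD q (fun y => (P n).[y]) x
       + lambda n * (P n).[x] = 0) /\
    (forall n, d2 n != 0) /\
    (forall m n,
       jackson_integrable q a b (fun x => (P n).[x] * (P m).[x] * rho x) /\
       jackson_int q a b (fun x => (P n).[x] * (P m).[x] * rho x)
       = (if m == n then d2 n else 0)).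
Proof.
move=> q0 q1 t1_neq0 s1_neq0 s2_neq0 a1_lt0 b1_gt0 b1_a2 a2_b2 Hsigma2 _.
move=> sigma1 tau lambda a b rho.
have q_neq0 : q != 0 by rewrite gt_eqF.
have q_neq1 : q != 1 by rewrite lt_eqF.
have a2_gt0 : 0 < a2 := lt_trans b1_gt0 b1_a2.
have b2_gt0 : 0 < b2 := lt_le_trans a2_gt0 a2_b2.
have ab0 : q * (s1 / 2 * (a1 * b1)) = s2 / 2 * (a2 * b2).
  by have := Hsigma2 0; rewrite mulr0 mul0r addr0 !sub0r; lra.
(* The quadratic coefficients are read off from the values at 0, 1 and -1. *)
have lead : q * (s1 / 2 + (1 - q^-1) * t1) = s2 / 2.
  by have := Hsigma2 0; have := Hsigma2 1; have := Hsigma2 (- 1); lra.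
(* Since [a1 * b1 < 0 < a2 * b2], the constant terms in [ab0] force opposite signs. *)
have sgn : s1 / 2 * (s2 / 2) < 0.
  have a2b2 : 0 < a2 * b2 by rewrite mulr_gt0.
  rewrite -(pmulr_llt0 _ a2b2) -(mulrA (s1 / 2)) -ab0.
  have -> : s1 / 2 * (q * (s1 / 2 * (a1 * b1))) = (s1 / 2) ^+ 2 * q * b1 * a1.
    by ring.
  have c1_neq0 : s1 / 2 != 0 by rewrite mulf_neq0// invr_neq0// pnatr_eq0.
  have c1_sqr : 0 < (s1 / 2) ^+ 2 by rewrite exprn_even_gt0.
  by rewrite pmulr_rlt0//; apply: mulr_gt0 b1_gt0; exact: mulr_gt0.
pose s : {poly R} := (s1 / 2) *: (('X - a1%:P) * ('X - b1%:P)).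
pose t : {poly R} := t1 *: 'X + t0%:P.
have sE x : s.[x] = s1 / 2 * (x - a1) * (x - b1).
  by rewrite /s hornerZ hornerM !hornerXsubC mulrA.
have tE x : t.[x] = t1 * x + t0.
  by rewrite /t hornerD hornerZ hornerX hornerC.
have s_size : (size s <= 3)%N.
  by rewrite (leq_trans (size_scale_leq _ _))// size_Mmonic ?monicXsubC//
    -?size_poly_eq0 !size_XsubC.
have t_size : (size t <= 2)%N.
  rewrite (leq_trans (size_polyD _ _))// geq_max (leq_trans (size_scale_leq _ _)).
    by rewrite (leq_trans (size_polyC_leq1 _)).
  by rewrite size_polyX.
have s_2 : s`_2 = s1 / 2.
  rewrite /s coefZ (_ : _`_2 = 1) ?mulr1//.
  have := monicMl ('X - b1%:P) (monicXsubC a1).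
  rewrite monicXsubC => /monicP; rewrite lead_coefE.
  by rewrite size_Mmonic ?monicXsubC -?size_poly_eq0 ?size_XsubC.
have t_1 : t`_1 = t1.
  by rewrite /t coefD coefZ coefX coefC mulr1 addr0.
pose e := qEHT_eigenvalue q s t.
have lambdaE n : lambda n = - e n.
  by rewrite /e qEHT_eigenvalueE s_2 t_1 /lambda; ring.
have e_inj k n : (k < n)%N -> e k != e n.
  by apply: qEHT_eigenvalue_inj => //; rewrite s_2 t_1 lead.
have /choice[P P_spec] : forall n, exists p : {poly R},
    size p = n.+1 /\ qEHT q s t p = e n *: p.
  move=> n; have [//||p sp Ep] := @triangular_eigenpoly R (qEHT q s t) e n.
  - by move=> k; exact: qEHT_triangular.
  - by move=> k; exact: e_inj.
  - by exists p.
have P_size n : size (P n) = n.+1 by case: (P_spec n).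
have P_eigen n : qEHT q s t (P n) = e n *: P n by case: (P_spec n).
have P_neq0 n : P n != 0 by rewrite -size_poly_eq0 P_size.
pose w (c : R) (j : nat) := bigqjacobi_weight q a b a2 b2 (q ^+ j * c).
(* These bounds make the weight positive along [q^j c]. At [c = a] and at [c = b] one of the
   arguments equals [q]. *)
pose support (c : R) := [/\ q * c / a < 1, q * c / b < 1, c / a2 < 1 & c / b2 < 1].
have supp_a : support a.
  split.
  - by rewrite mulfK// lt_eqF.
  - by rewrite (lt_trans _ ltr01)// pmulr_llt0 ?invr_gt0// pmulr_rlt0.
  - by rewrite (lt_trans _ ltr01)// pmulr_llt0 ?invr_gt0.
  - by rewrite (lt_trans _ ltr01)// pmulr_llt0 ?invr_gt0.
have supp_b : support b.
  split.
  - by rewrite (lt_trans _ ltr01)// nmulr_llt0 ?invr_lt0// mulr_gt0.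
  - by rewrite mulfK// gt_eqF.
  - by rewrite ltr_pdivrMr// mul1r.
  - by rewrite ltr_pdivrMr// mul1r (lt_le_trans b1_a2).
have w_gt0 c : support c -> forall j, 0 < w c j.
  by move=> [? ? ? ?] j; exact: bigqjacobi_weight_gt0.
have w_cvg c : support c -> w c @ \oo --> (1 : R).
  by move=> [? ? ? ?]; exact: bigqjacobi_weight_cvg.
have pearson c : support c -> forall j,
    w c j * (q * (s.[q ^+ j * c] + (1 - q^-1) * (q ^+ j * c) * t.[q ^+ j * c]))
    = q * w c j.+1 * s.[q ^+ j.+1 * c].
  move=> [ca cb ca2 cb2] j; rewrite !sE tE Hsigma2.
  have Hw := bigqjacobi_weight_rec q0 q1 ca cb ca2 cb2 j.
  rewrite -/(w c j) -/(w c j.+1) in Hw.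
  have [a_neq0 b_neq0] : a != 0 /\ b != 0 by rewrite lt_eqF// gt_eqF.
  have [a2_neq0 b2_neq0] : a2 != 0 /\ b2 != 0 by rewrite !gt_eqF.
  (* Factoring the zeros out of sigma1 and sigma2 leaves the constants that [ab0] matches. *)
  transitivity (s2 / 2 * (a2 * b2)
      * (w c j * ((1 - q ^+ j * c / a2) * (1 - q ^+ j * c / b2)))).
    by field; apply/andP.
  by rewrite Hw -ab0 /a /b; field; apply/andP.
pose L c n m := limn (fun N : nat =>
  \sum_(j < N) q ^+ j * ((P n * P m).[q ^+ j * c] * w c j)).
have L_cvg c n m : support c ->
    cvgn (fun N : nat => \sum_(j < N) q ^+ j * ((P n * P m).[q ^+ j * c] * w c j)).
  by move=> /w_cvg wc; exact: is_cvg_poly_sum.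
have sumE c n m : (fun N : nat =>
      \sum_(j < N) q ^+ j * ((P n).[q ^+ j * c] * (P m).[q ^+ j * c] * rho (q ^+ j * c)))
    = (fun N => \sum_(j < N) q ^+ j * ((P n * P m).[q ^+ j * c] * w c j)).
  by apply/funext => N; apply: eq_bigr => j _; rewrite hornerM.
have intE n m : jackson_int q a b (fun x => (P n).[x] * (P m).[x] * rho x)
    = (1 - q) * b * L b n m + (1 - q) * (- a) * L a n m.
  by rewrite /jackson_int /jackson_right /jackson_left !sumE.
have L_gt0 c n : support c -> c != 0 -> 0 < L c n n.
  by move=> sc c0; apply: qsum_sqr_gt0 => //; [exact: w_cvg | exact: w_gt0].
(* Taking the norms to be the integrals themselves makes the diagonal case immediate; their
   nonvanishing is shown separately. *)
exists P, (fun n => jackson_int q a b (fun x => (P n).[x] * (P n).[x] * rho x)).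
split=> //; split; [|split].
- move=> n x; have qV1 : q^-1 != 1 by rewrite invr_eq1.
  rewrite !qD_horner// lambdaE /sigma1 /tau -sE -tE.
  have := congr1 (horner^~ x) (P_eigen n).
  by rewrite /qEHT hornerD !hornerM => ->; rewrite hornerZ mulNr subrr.
- move=> n; rewrite intE.
  have Lb : 0 < L b n n by apply: L_gt0 => //; rewrite gt_eqF.
  have La : 0 < L a n n by apply: L_gt0 => //; rewrite lt_eqF.
  have q1' : 0 < 1 - q by rewrite subr_gt0.
  have na : 0 < - a by rewrite oppr_gt0.
  by apply/lt0r_neq0/addr_gt0; apply: mulr_gt0 => //; exact: mulr_gt0.
move=> m n; split.
  by split; rewrite /jackson_right /jackson_left sumE; exact: L_cvg.
case: eqP => [->//|/eqP mn].
have enm : e n != e m.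
  by move: mn; rewrite neq_ltn => /orP[/e_inj|/e_inj //]; rewrite eq_sym.
have side c : support c -> s.[c] = 0 -> (q - 1) * (e n - e m) * (c * L c n m)
    = q * s.[0] * (qcasoratian q (P n) (P m)).[0].
  move=> sc s0; rewrite mulrA.
  exact: (lagrange_limit q0 q1 s0 (w_cvg _ sc) (pearson _ sc) (P_eigen n) (P_eigen m)).
have side_a := side a supp_a; have side_b := side b supp_b.
(* Cancelling the nonzero eigenvalue factor gives [b * L b n m = a * L a n m], and the integral is a
   multiple of the difference of the two sides. *)
have : (q - 1) * (e n - e m) * (b * L b n m)
    = (q - 1) * (e n - e m) * (a * L a n m).
  by rewrite side_b ?side_a// sE /a /b subrr ?mul0r ?mulr0 ?mul0r.
move/mulfI => /(_ _) E; rewrite intE -!mulrA mulNr E ?mulrN ?subrr//.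
by rewrite mulf_neq0// subr_eq0.
Qed.
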